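(* Let $D\ge 1$ and let $M_1,\ldots,M_D$ be positive integers, not all equal to $1$, and let $p\in[0,1]$. Put $N=\prod_{d=1}^{D}M_d$ and $\gamma=\sum_{d=1}^{D}(M_d-1)$. Let $\mathcal{G}_{\mathrm{lat}}$ be the $D$-dimensional lattice graph of size $M_d$ along the $d$th dimension, let $\mathcal{G}_{\mathrm{perc}}=\mathcal{G}_{\mathrm{perc}}(\mathcal{G}_{\mathrm{lat}},p)$ be the random graph obtained by independently including each link of $\mathcal{G}_{\mathrm{lat}}$ with probability $p$, and set $$W=\frac{1}{\gamma}A(\mathcal{G}_{\mathrm{perc}}),\qquad B=\operatorname{E}[W],\qquad H=W-\operatorname{E}[W].$$ Let $C_{kk}(z)$, $k=1,\ldots,N$, be the unique solution in the class $L$ of the canonical system of equations $$C_{kk}(z)=\left[\left(B-zI_N-\left(\delta_{lj}\sum_{s=1}^{N}C_{ss}(z)\operatorname{E}[H_{js}^2]\right)_{l,j=1}^{N}\right)^{-1}\right]_{kk},\qquad k=1,\ldots,N,\quad \operatorname{Im}\{z\}\neq 0,$$ and define the $N\times N$ matrix $$C(z)=\left(B-zI_N-\left(\delta_{lj}\sum_{s=1}^{N}C_{ss}(z)\operatorname{E}[H_{js}^2]\right)_{l,j=1}^{N}\right)^{-1}.$$ Then there exist values $\alpha_{i_1,\ldots,i_D}(z)\in\mathbb{C}$, for $i_1,\ldots,i_D\in\{0,1\}$, such that $$C(z)=\sum_{i_1,\ldots,i_D=0}^{1}\alpha_{i_1,\ldots,i_D}(z)\bigotimes_{d=1}^{D}Y_{d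 i_d},\qquad Y_{d i_d}=\begin{cases}K_{M_d}, & i_d=0,\\ I_{M_d}, & i_d=1.\end{cases}$$
   Context: Notation: $K_M$ is the adjacency matrix of the complete graph on $M$ vertices (ones off the diagonal, zeros on the diagonal), $I_M$ is the $M\times M$ identity matrix, $\otimes$ is the Kronecker product, and $\delta_{lj}$ is the Kronecker delta. $A(\mathcal{G})$ denotes the $0/1$ adjacency matrix of an undirected graph $\mathcal{G}$ without self-loops. $(X_{lj})_{l,j=1}^{N}$ denotes the $N\times N$ matrix with entries $X_{lj}$. Lattice graph: the nodes of $\mathcal{G}_{\mathrm{lat}}$ are the $D$-tuples in $\{1,\ldots,M_1\}\times\cdots\times\{1,\ldots,M_D\}$, and two nodes are linked if and only if their tuples differ in exactly one coordinate. With nodes ordered compatibly with the Kronecker product, its adjacency matrix is $$A(\mathcal{G}_{\mathrm{lat}})=\sum_{j=1}^{D}\bigotimes_{d=1}^{D}X_{dj},\qquad X_{dj}=\begin{cases}K_{M_d}, & j=d,\\ I_{M_d}, & j\neq d.\end{cases}$$ Percolation model: $A(\mathcal{G}_{\mathrm{perc}})$ is the random symmetric matrix whose entries on and above the diagonal are independent, being Bernoulli($p$) at positions where $A(\mathcal{G}_{\mathrm{lat}})$ equals $1$ and $0$ elsewhere. Class $L$: the functions $X(z)$ that are analytic for $\operatorname{Im}\{z\}\neq 0$ with values in $\mathbb{C}$ and satisfy $\operatorname{Im}\{z\}\operatorname{Im}\{X(z)\}>0$. It is a known theorem of Girko (the K1 equation) that the canonical system of equations for such random matrices has a unique solution $C_{kk}(z)$,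 $k=1,\ldots,N$, with all $C_{kk}$ in the class $L$. *)

(* Defs.v *)
From mathcomp Require Export all_boot all_order all_algebra.
From mathcomp Require Export all_classical all_reals all_analysis.
From mathcomp Require Export complex mxtens.

Set Implicit Arguments.
Unset Strict Implicit.
Unset Printing Implicit Defensive.

Import Order.TTheory GRing.Theory Num.Theory.
Import numFieldNormedType.Exports.

Local Open Scope ring_scope.
Local Open Scope complex_scope.

Definition complete_mx (K : pzRingType) (m : nat) : 'M[K]_m :=
  \matrix_(i, j) (i != j)%:R.

(* A_1 (x) ... (x) A_D, associated to the left; the cast only identifies
   (M_1 ... M_D) * M_(D+1) with M_1 ... M_(D+1). *)
Fixpoint kron (K : pzRingType) (D : nat) :
    forall M : 'I_D -> nat, (forall d, 'M[K]_(M d)) ->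
      'M[K]_(\prod_(d < D) M d) :=
  match D with
  | 0 => fun M _ => 1%:M
  | D'.+1 => fun M A =>
      castmx (esym (big_ord_recr D' M), esym (big_ord_recr D' M))
        (kron (fun d => A (widen_ord (leqnSn D') d)) *t A ord_max)
  end.

Section Lattice.

Variables (D : nat) (M : 'I_D -> nat).

Let N := (\prod_(d < D) M d)%N.

(* The sides are 0-based: coordinate d ranges over {0, ..., M d - 1}. *)
Definition node := {dffun forall d : 'I_D, 'I_(M d)}.

Lemma side_gt0 (k : 'I_N) (d : 'I_D) : (0 < M d)%N.
Proof.
have: (0 < N)%N by apply: leq_ltn_trans (ltn_ord k).
by rewrite /N (bigD1 d) //= muln_gt0 => /andP[].
Qed.

(* Lexicographic enumeration of the nodes (the last coordinate varies fastest):
   the order compatible with the Kronecker product, see kronE. *)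
Definition coord (k : 'I_N) (d : 'I_D) : 'I_(M d) :=
  Ordinal (ltn_pmod (k %/ \prod_(e < D | (d < e)%N) M e) (side_gt0 k d)).

Definition node_of (k : 'I_N) : node := [ffun d => coord k d].

(* An undirected graph without self-loops is given by its set of links, each
   link being a two-element set of nodes. *)
Definition graph := {set {set node}}.

Definition lattice : graph :=
  [set l : {set node} | [exists x : node, [exists y : node,
     (l == [set x; y]%SET) &&
     (#|[pred d | x d != y d]| == 1%N)]]].

Definition adjacency (K : pzRingType) (G : graph) : 'M[K]_N :=
  \matrix_(i, j)
    ([set node_of i; node_of j]%SET \in G)%:R.

End Lattice.

Section Random.

Context (disp : measure_display) (T : measurableType disp) (R : realType).
Variable P : probability T R.

Definition mutually_independent (I : finType) (A : {set I}) (E : I -> set T) :=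
  forall S : {set I}, S \subset A ->
    P (\bigcap_(i in [set` S]) E i)%classic = (\prod_(i in S) P (E i))%E.

Definition link_event D (M : 'I_D -> nat) (G : T -> graph M) (l : {set node M})
  : set T := [set w | l \in G w]%classic.

Record percolation D (M : 'I_D -> nat) (G0 : graph M) (p : R)
    (G : T -> graph M) : Prop := Percolation {
  perc_sub : forall w, G w \subset G0;
  perc_measurable : forall l, measurable (link_event G l);
  perc_prob : forall l, l \in G0 -> P (link_event G l) = p%:E;
  perc_indep : mutually_independent G0 (link_event G) }.

Definition mean_mx m n (W : T -> 'M[R]_(m, n)) : 'M[R]_(m, n) :=
  \matrix_(i, j) fine 'E_P[(fun w => W w i j)]%E.

(* The entries E[H_js ^ 2], where H = W - E[W]. *)
Definition variance_mx m n (W : T -> 'M[R]_(m, n)) : 'M[R]_(m, n) :=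
  \matrix_(j, s) fine 'E_P[(fun w => (W w - mean_mx W) j s ^+ 2)%R]%E.

End Random.

Section CanonicalSystem.

Variable R : realType.

(* Only the values of X off the real axis matter. R[i]^o is R[i] seen as a
   normed space over itself, so derivability is complex differentiability. *)
Definition class_L (X : R[i] -> R[i]) : Prop :=
  forall z : R[i], complex.Im z != 0 ->
    derivable (X : R[i]^o -> R[i]^o) z 1 /\
    0 < complex.Im z * complex.Im (X z).

(* C(z), with c s standing for C_ss(z) and V j s for E[H_js ^ 2]. invmx is
   total; for C_ss in class_L, B symmetric and V nonnegative the inverted matrix
   has a definite imaginary part off the real axis, hence is invertible. *)
Definition canonical_mx N (B V : 'M[R]_N) (c : 'I_N -> R[i]) (z : R[i]) :
    'M[R[i]]_N :=
  invmx (map_mx (real_complex R) B - z%:M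
         - \matrix_(l, j) ((l == j)%:R * \sum_(s < N) c s * (V j s)%:C)).

Definition canonical_solution N (B V : 'M[R]_N) (C : 'I_N -> R[i] -> R[i]) :=
  forall z : R[i], complex.Im z != 0 -> forall k,
    C k z = canonical_mx B V (C^~ z) z k k.

End CanonicalSystem.

Lemma coord_widen D (M : 'I_D.+1 -> nat) (k : 'I_(\prod_(d < D.+1) M d)) d :
  coord (mxtens_unindex (cast_ord (big_ord_recr D M) k)).1 d =
  coord k (widen_ord (leqnSn D) d).
Proof.
apply: val_inj => /=; congr (_ %% _)%N; rewrite -divnMA; congr (_ %/ _)%N.
rewrite [RHS]big_mkcond big_ord_recr /= ltn_ord mulnC.
by congr (_ * _)%N; rewrite [LHS]big_mkcond.
Qed.

Lemma coord_last D (M : 'I_D.+1 -> nat) (k : 'I_(\prod_(d < D.+1) M d)) :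
  (mxtens_unindex (cast_ord (big_ord_recr D M) k)).2 = coord k ord_max.
Proof.
apply: val_inj => /=; rewrite [X in (_ %/ X)%N]big_pred0 ?divn1 // => e.
by rewrite ltnNge -ltnS ltn_ord.
Qed.

Lemma coord_inj D (M : 'I_D -> nat) (i j : 'I_(\prod_(d < D) M d)) :
  (forall d, coord i d = coord j d) -> i = j.
Proof.
elim: D M i j => [|D IH] M i j eq_ij.
  have z0 (k : 'I_(\prod_(d < 0) M d)) : k = 0%N :> nat.
    have := ltn_ord k; rewrite [X in (_ < X)%N]big_ord0.
    by rewrite ltnS leqn0 => /eqP.
  by apply: val_inj; rewrite /= !z0.
apply: (@cast_ord_inj _ _ (big_ord_recr D M)); apply: (can_inj (@mxtens_unindexK _ _)).
rewrite [LHS]surjective_pairing [RHS]surjective_pairing !coord_last eq_ij.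
by congr (_, _); apply: IH => d; rewrite !coord_widen.
Qed.

Lemma kronE (K : comPzRingType) D (M : 'I_D -> nat) (A : forall d, 'M[K]_(M d))
    (i j : 'I_(\prod_(d < D) M d)) :
  kron A i j = \prod_(d < D) A d (coord i d) (coord j d).
Proof.
elim: D M A i j => [|D IH] M A i j.
  by rewrite [RHS]big_ord0 /= mxE (_ : i = j) ?eqxx //; apply: coord_inj => -[].
rewrite [RHS]big_ord_recr /= castmxE mxE !esymK IH !coord_last; congr (_ * _).
by apply: eq_bigr => d _; rewrite !coord_widen.
Qed.

Lemma node_of_bij D (M : 'I_D -> nat) : bijective (@node_of D M).
Proof.
apply: inj_card_bij => [i j /ffunP eq_ij|].
  by apply: coord_inj => d; have := eq_ij d; rewrite !ffunE.
rewrite card_ord card_dep_ffun foldrE big_map big_enum /=.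
by rewrite (eq_bigr M) // => d _; rewrite card_ord.
Qed.

Lemma mem_lattice D (M : 'I_D -> nat) (x y : node M) :
  ([set x; y]%SET \in lattice M) = (#|[pred d | x d != y d]| == 1%N).
Proof.
rewrite inE; apply/existsP/idP => [[u /existsP[v /andP[/eqP eq_xy uv1]]]|xy1].
  have uv : u != v by apply: contraTneq uv1 => ->; rewrite eq_card0 // => d; rewrite !inE eqxx.
  have sym : #|[pred d | v d != u d]| = #|[pred d | u d != v d]|.
    by apply: eq_card => d; rewrite !inE eq_sym.
  have := set21 x y; rewrite eq_xy !inE => /orP[]/eqP xE;
  have := set22 x y; rewrite eq_xy !inE => /orP[]/eqP yE; subst x y => //.
  - by move/setP/(_ v): eq_xy; rewrite !inE eqxx orbT !(eq_sym v) (negPf uv).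
  - by rewrite sym.
  - by move/setP/(_ u): eq_xy; rewrite !inE eqxx (negPf uv).
by exists x; apply/existsP; exists y; rewrite eqxx.
Qed.

Lemma adjacency_lattice (K : comPzRingType) D (M : 'I_D -> nat) :
  adjacency K (lattice M) =
  \sum_(j < D) kron (fun d => if j == d then complete_mx K (M d) else 1%:M).
Proof.
apply/matrixP => k l; rewrite mxE mem_lattice summxE.
have diff : [pred d | node_of k d != node_of l d] =i [pred d | coord k d != coord l d].
  by move=> d; rewrite !inE !ffunE.
rewrite (eq_card diff).
under eq_bigr do rewrite kronE.
have facE (j : 'I_D) : \prod_(d < D) (if j == d then complete_mx K (M d) else 1%:M)
    (coord k d) (coord l d) =
    [forall d, (coord k d != coord l d) == (j == d)]%:R :> K.
  case: (boolP [forall d, _]) => [/forallP eq_d|].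
    rewrite big1 // => d _; have := eq_d d; case: (j == d) => /eqP E.
      by rewrite mxE E.
    by rewrite mxE; move/negbFE: E => ->.
  rewrite negb_forall => /existsP[d neq_d]; rewrite (bigD1 d) //=.
  case: (j == d) neq_d; rewrite mxE => /eqP; case: (_ == _) => //=; by rewrite ?mul0r.
under eq_bigr do rewrite facE.
rewrite -natr_sum; congr (_%:R).
case: (boolP (_ == 1%N)) => /=.
  case/card1P => j jP; rewrite (bigD1 j) //= big1 ?addn0 => [|i ij].
    rewrite (_ : [forall d, _]) //; apply/forallP => d.
    by have := jP d; rewrite !inE => ->; rewrite [j == d]eq_sym.
  apply/eqP; rewrite eqb0; apply: contra ij => /forallP/(_ i).
  by have := jP i; rewrite !inE => ->; rewrite eqxx eqb_id.
move=> n1; rewrite big1 // => j _; apply/eqP; rewrite eqb0.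
apply: contra n1 => /forallP jP; apply/card1P; exists j => d.
by rewrite !inE (eqP (jP d)) [j == d]eq_sym.
Qed.

(* Main.v *)
From mathcomp Require Import perm ring lra.
Require Import Defs.

(** The matrix C(z) is invariant under the automorphisms of the lattice graph
    that permute each coordinate separately, because the canonical system is
    and its solution is unique; the matrices with that invariance are exactly
    the combinations of Kronecker products of K and I.

    Invariance of the data.  Whether two nodes are linked depends only on the
    set of coordinates on which they agree ([agree]).  The entries of E[W] and
    of the variance matrix at (i, j) are determined by whether {i, j} is a link
    of the lattice, so they depend on [agree i j] only.

    Uniqueness.  Fix z off the real axis, write A_c = B - z - diag(S_c), with
    S_c(j) = sum_s c_s V_js, for the matrix inverted in the canonical system,
    and g = A_c^-1.  Taking the imaginary part of g_k A_c g_k^*, where g_k is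
    the k-th row of g, kills B and gives

      Im z * Im g_kk = sum_j |g_kj|^2 ((Im z)^2 + sum_s V_js u_s),

    with u_s = Im z * Im c_s.  For a solution g_kk = c_k, so the left side is
    u_k, and u is a positive vector which strictly dominates its image under the nonnegative matrix |g|^2 V.  For two solutions
    c, c' with inverses g, g' and vectors u, u', the resolvent identity and the
    symmetry of g' give

      |c_k - c'_k| <= sum_js |g_kj| |g'_kj| V_js |c_s - c'_s|.

    The arithmetic-geometric mean inequality weighted by u and u' makes the
    matrix on the right a strict contraction ([subharmonic_eq0]), so c = c'.
    No sign is chosen for Im z: multiplying by Im z covers both half-planes.

    Conclusion.  If f preserves B and V, then c o f solves the system together
    with c, hence c o f = c and C(z) is f-invariant
    ([canonical_mx_invariant]).  Pairs of nodes with the same agreement set are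
    carried to each other by a permutation acting coordinate by coordinate
    ([lattice_two_point_homogeneous]), so C(z)_kl is a function of [agree k l];
    such a matrix is a combination of the Kronecker products, which are the
    indicators of the agreement sets ([kron_span]). *)

Set Implicit Arguments.
Unset Strict Implicit.
Unset Printing Implicit Defensive.

Import Order.TTheory GRing.Theory Num.Theory.
Local Open Scope ring_scope.
Local Open Scope complex_scope.
Local Notation normc := ComplexField.Normc.normc.

(** * A comparison principle for nonnegative matrices *)

(** Put K_ks = sum_j g_kj h_kj V_js.  By the arithmetic-geometric mean
    inequality, K maps the weight sqrt (u v) strictly below itself, since
    |g|^2 V does so with u and |h|^2 V with v.  Hence the ratio
    delta / sqrt (u v) cannot be positive at the index where it is largest. *)
Lemma subharmonic_eq0 (R : rcfType) (n : nat) (g h V : 'I_n -> 'I_n -> R)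
    (u v delta : 'I_n -> R) :
  (forall k j, 0 <= g k j) -> (forall k j, 0 <= h k j) ->
  (forall j s, 0 <= V j s) ->
  (forall k, 0 < u k) -> (forall k, 0 < v k) ->
  (forall k, \sum_j \sum_s g k j ^+ 2 * V j s * u s < u k) ->
  (forall k, \sum_j \sum_s h k j ^+ 2 * V j s * v s < v k) ->
  (forall k, 0 <= delta k) ->
  (forall k, delta k <= \sum_j \sum_s g k j * h k j * V j s * delta s) ->
  forall k, delta k = 0.
Proof.
move=> g0 h0 V0 u0 v0 gu hv d0 dle k0.
pose a k := Num.sqrt (u k); pose b k := Num.sqrt (v k).
have a0 k : 0 < a k by rewrite sqrtr_gt0.
have b0 k : 0 < b k by rewrite sqrtr_gt0.
have aE k : a k ^+ 2 = u k by rewrite sqr_sqrtr ?ltW.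
have bE k : b k ^+ 2 = v k by rewrite sqr_sqrtr ?ltW.
pose rho k := delta k / (a k * b k).
have ab0 k : 0 < a k * b k by rewrite mulr_gt0.
have dE k : delta k = rho k * (a k * b k) by rewrite divfK ?gt_eqF.
have r0 k : 0 <= rho k by rewrite divr_ge0 // ltW.
case: (@Order.TotalTheory.arg_maxP _ _ _ k0 xpredT rho erefl) => k _ kmaxT.
have kmax j : rho j <= rho k by apply: kmaxT.
suff rk : rho k <= 0.
  have /eqP : rho k0 == 0 by rewrite eq_le r0 andbT (le_trans _ rk) // kmax.
  by rewrite dE => ->; rewrite mul0r.
rewrite leNgt; apply/negP => rk.
suff : 2 * (a k * b k) * delta k < 2 * (a k * b k) * delta k by rewrite ltxx.
(* The difference is a nonnegative multiple of a square once delta s is replaced by its bound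
   rho k * sqrt (u s * v s). *)
have ineq j s : 2 * (a k * b k) * (g k j * h k j * V j s * delta s) <=
    rho k * (v k * (g k j ^+ 2 * V j s * u s) + u k * (h k j ^+ 2 * V j s * v s)).
  have c0 : 0 <= 2 * (a k * b k) * (g k j * h k j * V j s) by rewrite !mulr_ge0 // ltW.
  have ds : delta s <= rho k * (a s * b s).
    by rewrite dE ler_wpM2r ?(ltW (ab0 s)) //; apply: kmax.
  rewrite [leLHS]mulrA; apply: le_trans (ler_wpM2l c0 ds) _.
  rewrite -!aE -!bE -subr_ge0.
  rewrite (_ : _ - _ = rho k * V j s * (b k * g k j * a s - a k * h k j * b s) ^+ 2);
    last by ring.
  by rewrite mulr_ge0 ?sqr_ge0 // mulr_ge0.
have h2 : 2 * (a k * b k) * delta k <=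
    2 * (a k * b k) * \sum_j \sum_s g k j * h k j * V j s * delta s.
  by rewrite ler_wpM2l // mulr_ge0 // ltW.
apply: (le_lt_trans h2).
have h3 : 2 * (a k * b k) * \sum_j \sum_s g k j * h k j * V j s * delta s <=
   rho k * (v k * (\sum_j \sum_s g k j ^+ 2 * V j s * u s)
          + u k * (\sum_j \sum_s h k j ^+ 2 * V j s * v s)).
  rewrite !mulr_sumr -big_split /= mulr_sumr; apply: ler_sum => j _.
  rewrite !mulr_sumr -big_split /= mulr_sumr; apply: ler_sum => s _.
  exact: ineq.
apply: (le_lt_trans h3).
rewrite dE (_ : 2 * _ * _ = rho k * (v k * u k + u k * v k)); last first.
  by rewrite -aE -bE; ring.
by rewrite ltr_pM2l // ltrD // ltr_pM2l.
Qed.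

(** * Complex sums *)

Lemma Im_sum (R : rcfType) (I : Type) (r : seq I) (Q : pred I) (F : I -> R[i]) :
  complex.Im (\sum_(i <- r | Q i) F i) = \sum_(i <- r | Q i) complex.Im (F i).
Proof. by apply: (big_morph (@complex.Im R)) => // -[? ?] [? ?]. Qed.

Lemma normc_sum (R : rcfType) (I : Type) (r : seq I) (Q : pred I) (F : I -> R[i]) :
  normc (\sum_(i <- r | Q i) F i) <= \sum_(i <- r | Q i) normc (F i).
Proof.
elim/big_rec2: _ => [|i y x _ le_xy]; first by rewrite ComplexField.Normc.normc0.
by apply: le_trans (le_normcD _ _) _; rewrite lerD2l.
Qed.

Lemma normc_ge0 (R : rcfType) (x : R[i]) : 0 <= normc x.
Proof. by case: x => a b; rewrite /= sqrtr_ge0. Qed.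

Lemma sqr_normcE (R : rcfType) (x : R[i]) :
  normc x ^+ 2 = complex.Re x ^+ 2 + complex.Im x ^+ 2.
Proof. by case: x => a b; rewrite /= sqr_sqrtr // addr_ge0 ?sqr_ge0. Qed.

(** * The canonical system at a fixed spectral parameter *)

Section Dyson.
Variables (R : realType) (n : nat).
Implicit Types (B V : 'M[R]_n) (c : 'I_n -> R[i]) (z : R[i]).

Definition self_energy V c (j : 'I_n) : R[i] := \sum_s c s * (V j s)%:C.

Definition dyson_mx B V c z : 'M[R[i]]_n :=
  map_mx (real_complex R) B - z%:M
  - \matrix_(l, j) ((l == j)%:R * self_energy V c j).

Lemma canonical_mxE B V c z : canonical_mx B V c z = invmx (dyson_mx B V c z).
Proof. by []. Qed.

Lemma Im_self_energy V c j :
  complex.Im (self_energy V c j) = \sum_s complex.Im (c s) * V j s.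
Proof.
by rewrite Im_sum; apply: eq_bigr => s _; case: (c s) => a b /=; rewrite mulr0 add0r.
Qed.

Lemma dyson_mx_row B V c z (x : 'rV_n) j :
  (x *m dyson_mx B V c z) 0 j =
  (\sum_i x 0 i * (B i j)%:C) - x 0 j * (z + self_energy V c j).
Proof.
have mxB (X Y : 'rV[R[i]]_n) k : (X - Y) 0 k = X 0 k - Y 0 k by rewrite !mxE.
rewrite !mulmxBr !mxB mul_mx_scalar mulrDr opprD addrA.
congr (_ - _ - _).
- by rewrite mxE; apply: eq_bigr => i _; rewrite !mxE.
- by rewrite mxE mulrC.
- rewrite mxE (bigD1 j) //= !mxE eqxx mul1r big1 ?addr0 // => i ij.
  by rewrite mxE (negPf ij) mul0r mulr0.
Qed.

(** A real symmetric B contributes a real number to the form x A x^*, so only the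
    diagonal part z + S is seen by the imaginary part. *)
Lemma Im_dyson_form B V c z (x : 'rV_n) : B^T = B ->
  complex.Im (\sum_j (x *m dyson_mx B V c z) 0 j * (x 0 j)^*) =
  - \sum_j normc (x 0 j) ^+ 2 * complex.Im (z + self_energy V c j).
Proof.
move=> Bsym.
have Bs i j : B i j = B j i by rewrite -[in LHS]Bsym mxE.
(* T is antisymmetric, so its total sum vanishes. *)
pose T i j := complex.Im (x 0 i * (B i j)%:C * (x 0 j)^*).
have TN i j : T i j = - T j i.
  rewrite /T (Bs i j); case: (x 0 i) => a b; case: (x 0 j) => a' b' /=.
  by ring.
have T0 : \sum_j \sum_i T i j = 0.
  have : \sum_j \sum_i T i j = - \sum_j \sum_i T i j.
    rewrite [LHS]exchange_big -sumrN; apply: eq_bigr => j _.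
    by rewrite -sumrN; apply: eq_bigr => i _.
  by move=> e; lra.
transitivity (\sum_j \sum_i T i j
    - \sum_j normc (x 0 j) ^+ 2 * complex.Im (z + self_energy V c j)); last first.
  by rewrite T0 add0r.
rewrite Im_sum -sumrB; apply: eq_bigr => j _.
rewrite dyson_mx_row mulrBl mulr_suml /=.
have ImB (y y' : R[i]) : complex.Im (y - y') = complex.Im y - complex.Im y'.
  by case: y y' => [? ?] [? ?].
rewrite ImB Im_sum; congr (_ - _); rewrite sqr_normcE.
by case: (x 0 j) (z + _) => a b [a' b'] /=; ring.
Qed.

Section HalfPlane.
Variables (B V : 'M[R]_n) (z : R[i]).
Hypotheses (Bsym : B^T = B) (V0 : forall j s, 0 <= V j s) (z0 : complex.Im z != 0).

(** The pointwise content of membership in the class L: c takes its values in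
    the open half-plane, upper or lower, that contains z. *)
Definition same_side c := forall k, 0 < complex.Im z * complex.Im (c k).

Lemma Im_dyson_diag c j :
  complex.Im z * complex.Im (z + self_energy V c j) =
  complex.Im z ^+ 2 + \sum_s V j s * (complex.Im z * complex.Im (c s)).
Proof.
have -> : complex.Im (z + self_energy V c j) = complex.Im z + complex.Im (self_energy V c j).
  by case: z (self_energy _ _ _) => [? ?] [? ?].
rewrite Im_self_energy mulrDr expr2 mulr_sumr; congr (_ + _).
by apply: eq_bigr => s _; ring.
Qed.

Lemma dyson_diag_gt0 c j : same_side c ->
  0 < complex.Im z * complex.Im (z + self_energy V c j).
Proof.
move=> cz; rewrite Im_dyson_diag ltr_pwDl ?exprn_even_gt0 //.
by apply: sumr_ge0 => s _; rewrite mulr_ge0 // ltW.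
Qed.

(** A row vector x of the kernel makes the form x A x^* vanish, although the
    imaginary part of this form is definite. *)
Lemma dyson_mx_unit c : same_side c -> dyson_mx B V c z \in unitmx.
Proof.
move=> cz; rewrite -row_free_unit -kermx_eq0; apply/negPn/negP => /rowV0Pn[x].
move=> /sub_kermxP xA /negP; apply.
have := Im_dyson_form V c z x Bsym.
rewrite xA big1 => [|j _]; last by rewrite mxE mul0r.
move/eqP; rewrite /= eq_sym oppr_eq0 => /eqP sum0.
have /psumr_eq0P term0 : \sum_j normc (x 0 j) ^+ 2 *
    (complex.Im z * complex.Im (z + self_energy V c j)) = 0.
  transitivity (complex.Im z * 0); last by rewrite mulr0.
  rewrite -[X in _ * X]sum0 mulr_sumr.
  by apply: eq_bigr => j _; rewrite mulrCA.
apply/eqP/rowP => j; rewrite [RHS]mxE; apply: ComplexField.Normc.eq0_normc.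
have /eqP := term0 (fun k _ => mulr_ge0 (sqr_ge0 _) (ltW (dyson_diag_gt0 k cz))) j isT.
by rewrite mulf_eq0 sqrf_eq0 (gt_eqF (dyson_diag_gt0 j cz)) orbF => /eqP.
Qed.

(** The Ward identity: the form x A x^* at the k-th row x of g = A^-1 is the
    conjugate of g_kk, because x A is the k-th basis vector. *)
Lemma Im_canonical_diag c k : same_side c ->
  let g := canonical_mx B V c z in
  complex.Im z * complex.Im (g k k) =
  \sum_j normc (g k j) ^+ 2 *
    (complex.Im z ^+ 2 + \sum_s V j s * (complex.Im z * complex.Im (c s))).
Proof.
move=> cz /=; set g := canonical_mx _ _ _ _.
have := Im_dyson_form V c z (row k g) Bsym.
rewrite -row_mul /g canonical_mxE mulVmx ?dyson_mx_unit // -canonical_mxE -/g.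
rewrite (bigD1 k) //= big1 ?addr0 => [|j jk]; last first.
  by rewrite !mxE eq_sym (negPf jk) mul0r.
rewrite !mxE eqxx mul1r => e.
have {e} : complex.Im (g k k) = \sum_j normc (row k g 0 j) ^+ 2 *
    complex.Im (z + self_energy V c j).
  by apply: oppr_inj; rewrite -e; case: (g k k).
move=> ->; rewrite mulr_sumr; apply: eq_bigr => j _.
by rewrite mulrCA Im_dyson_diag mxE.
Qed.

Lemma dyson_mx_sym c : (dyson_mx B V c z)^T = dyson_mx B V c z.
Proof.
apply/matrixP => i j; rewrite !mxE -[in RHS]Bsym mxE (eq_sym j).
by case: eqP => [->|_] //; rewrite !mul0r.
Qed.

(** The resolvent identity g - g' = g (A' - A) g', where A' - A is diagonal and
    g'_jk = g'_kj. *)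
Lemma canonical_mx_sub c c' : same_side c -> same_side c' -> forall k,
  canonical_mx B V c z k k - canonical_mx B V c' z k k =
  \sum_j \sum_s canonical_mx B V c z k j * canonical_mx B V c' z k j *
    (V j s)%:C * (c s - c' s).
Proof.
move=> cz cz' k; rewrite !canonical_mxE.
set A := dyson_mx B V c z; set A' := dyson_mx B V c' z.
have uA : A \in unitmx by exact: dyson_mx_unit.
have uA' : A' \in unitmx by exact: dyson_mx_unit.
have sym j : invmx A' k j = invmx A' j k.
  by have : A'^T = A' := dyson_mx_sym c'; move=> {1}<-; rewrite -trmx_inv mxE.
have E : invmx A - invmx A' = invmx A *m (A' - A) *m invmx A'.
  by rewrite mulmxBr mulVmx // mulmxBl mul1mx -mulmxA mulmxV // mulmx1.
have -> : invmx A k k - invmx A' k k = (invmx A - invmx A') k k by rewrite !mxE.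
have dA : A' - A = diag_mx (\row_j (self_energy V c j - self_energy V c' j)).
  apply/matrixP => i j; rewrite !mxE; case: eqP => [->|_]; rewrite ?mulr1n ?mulr0n; ring.
rewrite E dA mxE; apply: eq_bigr => j _.
rewrite mul_mx_diag mxE mxE -sym /self_energy -sumrB mulr_sumr mulr_suml.
by apply: eq_bigr => s _; ring.
Qed.

(** Uniqueness holds separately at each z.  The Ward identity provides the two
    weights, and the resolvent identity the inequality, to which
    [subharmonic_eq0] applies. *)
Lemma canonical_solution_unique c c' : same_side c -> same_side c' ->
  (forall k, c k = canonical_mx B V c z k k) ->
  (forall k, c' k = canonical_mx B V c' z k k) -> c =1 c'.
Proof.
move=> cz cz' cE cE' k; apply/eqP; rewrite -subr_eq0; apply/eqP.
apply: ComplexField.Normc.eq0_normc.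
pose u c (k : 'I_n) := complex.Im z * complex.Im (c k).
have uP (e : 'I_n -> R[i]) : same_side e -> (forall k, e k = canonical_mx B V e z k k) ->
    forall k, \sum_j \sum_s normc (canonical_mx B V e z k j) ^+ 2 * V j s * u e s < u e k.
  move=> ez eE i.
  have := Im_canonical_diag i ez; rewrite /= -eE -/(u e i) => uE.
  (* u e i > 0 forces a nonzero entry in row i, whose (Im z)^2 term makes the
     inequality strict. *)
  have [j jP] : exists j, normc (canonical_mx B V e z i j) != 0.
    apply/existsP; apply: contraTT (ez i) => /existsPn g0.
    rewrite -/(u e i) uE big1 ?ltxx // => j _.
    by have /negPn/eqP -> := g0 j; rewrite expr0n mul0r.
  rewrite [ltRHS]uE -subr_gt0 -sumrB (bigD1 j) //=.
  have dE l : normc (canonical_mx B V e z i l) ^+ 2 *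
      (complex.Im z ^+ 2 + \sum_s V l s * (complex.Im z * complex.Im (e s)))
      - \sum_s normc (canonical_mx B V e z i l) ^+ 2 * V l s * u e s =
      normc (canonical_mx B V e z i l) ^+ 2 * complex.Im z ^+ 2.
    rewrite mulrDr mulr_sumr -addrA -sumrB big1 ?addr0 // => s _.
    by rewrite /u; ring.
  rewrite ltr_pwDl // ?dE; first by rewrite mulr_gt0 ?exprn_even_gt0.
  by apply: sumr_ge0 => l _; rewrite dE mulr_ge0 ?sqr_ge0.
apply: (@subharmonic_eq0 _ _ (fun k j => normc (canonical_mx B V c z k j))
  (fun k j => normc (canonical_mx B V c' z k j)) V (u c) (u c')
  (fun k => normc (c k - c' k))) => //.
- by move=> *; exact: normc_ge0.
- by move=> *; exact: normc_ge0.
- exact: uP.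
- exact: uP.
- by move=> *; exact: normc_ge0.
move=> {}k; rewrite {1}cE {1}cE' canonical_mx_sub //.
apply: le_trans (normc_sum _ _ _) _; apply: ler_sum => j _.
apply: le_trans (normc_sum _ _ _) _; apply: ler_sum => s _.
rewrite !ComplexField.Normc.normcM (_ : normc (V j s)%:C = V j s) //.
by rewrite /= expr0n addr0 sqrtr_sqr ger0_norm.
Qed.

Lemma canonical_mx_reindex c (f : 'I_n -> 'I_n) : same_side c -> injective f ->
  (forall i j, B (f i) (f j) = B i j) -> (forall i j, V (f i) (f j) = V i j) ->
  canonical_mx B V (c \o f) z = mxsub f f (canonical_mx B V c z).
Proof.
move=> cz f_inj Bf Vf; rewrite !canonical_mxE.
have -> : dyson_mx B V (c \o f) z = mxsub f f (dyson_mx B V c z).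
  apply/matrixP => i j; rewrite !mxE Bf (inj_eq f_inj); congr (_ - _ * _).
  rewrite [RHS](reindex_inj f_inj); apply: eq_bigr => s _.
  by rewrite Vf.
set A := dyson_mx B V c z.
have e1 : mxsub f f A *m mxsub f f (invmx A) = 1%:M.
  have -> : 1%:M = mxsub f f (A *m invmx A).
    rewrite mulmxV ?dyson_mx_unit //; apply/matrixP => i j.
    by rewrite !mxE (inj_eq f_inj).
  apply/matrixP => i j; rewrite !mxE [RHS](reindex_inj f_inj).
  by apply: eq_bigr => s _; rewrite !mxE.
have [u _] := mulmx1_unit e1.
by rewrite -[LHS]mulmx1 -e1 mulKmx.
Qed.

(** A symmetry f of B and V turns the solution c into the solution c o f, which
    uniqueness identifies with c. *)
Lemma canonical_mx_invariant c (f : 'I_n -> 'I_n) : same_side c ->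
  (forall k, c k = canonical_mx B V c z k k) -> injective f ->
  (forall i j, B (f i) (f j) = B i j) -> (forall i j, V (f i) (f j) = V i j) ->
  forall i j, canonical_mx B V c z (f i) (f j) = canonical_mx B V c z i j.
Proof.
move=> cz cE f_inj Bf Vf i j.
have re := canonical_mx_reindex cz f_inj Bf Vf.
have cf : c \o f =1 c.
  apply: canonical_solution_unique => // [k|k]; first exact: cz.
  by rewrite re mxE /= -cE.
by rewrite -[in RHS](funext cf) re mxE.
Qed.

End HalfPlane.
End Dyson.

(** * Symmetries of the lattice *)

(** The second transposition corrects the image of y; it fixes x' as soon as
    x, y and x', y' have the same equality type. *)
Definition two_point_perm (T : finType) (x y x' y' : T) : {perm T} :=
  (tperm x x' * tperm (tperm x x' y) y')%g.

Lemma two_point_permP (T : finType) (x y x' y' : T) : (x == y) = (x' == y') ->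
  two_point_perm x y x' y' x = x' /\ two_point_perm x y x' y' y = y'.
Proof.
move=> eq_xy; rewrite !permM tpermL tpermL; split=> //.
case: (eqVneq x y) eq_xy => [<-|xy] /esym; first by move/eqP->; rewrite tpermL tperm1 perm1.
move=> /negbT xy'; apply: tpermD; last by rewrite eq_sym.
by rewrite -[X in _ != X](tpermL x x') (inj_eq perm_inj) eq_sym.
Qed.

Section Lattice.
Variables (D : nat) (M : 'I_D -> nat).
Local Notation N := (\prod_(d < D) M d)%N.
Implicit Types i j k l : 'I_N.

Definition agree k l : {ffun 'I_D -> bool} := [ffun d => coord k d == coord l d].

Lemma mem_lattice_agree i j i' j' : agree i j = agree i' j' ->
  ([set node_of i; node_of j]%SET \in lattice M) =
  ([set node_of i'; node_of j']%SET \in lattice M).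
Proof.
move=> eq_ij; rewrite !mem_lattice; congr (_ == _); apply: eq_card => d.
by have /ffunP/(_ d) := eq_ij; rewrite !inE !ffunE => ->.
Qed.

(** Permuting each coordinate separately preserves agreement sets, and in each
    coordinate a permutation can move two points to any two points of the same
    equality type. *)
Lemma lattice_two_point_homogeneous k l k' l' : agree k l = agree k' l' ->
  exists f : 'I_N -> 'I_N,
    [/\ forall i j, agree (f i) (f j) = agree i j, injective f, f k = k' & f l = l'].
Proof.
move=> /ffunP eq_kl; have [g gK Kg] := node_of_bij M.
pose s d := two_point_perm (coord k d) (coord l d) (coord k' d) (coord l' d).
have sP d : s d (coord k d) = coord k' d /\ s d (coord l d) = coord l' d.
  by apply: two_point_permP; have := eq_kl d; rewrite !ffunE.
pose f i := g [ffun d => s d (coord i d)].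
have fE i d : coord (f i) d = s d (coord i d).
  have /ffunP/(_ d) := Kg [ffun d => s d (coord i d)].
  by rewrite !ffunE.
exists f; split.
- by move=> i j; apply/ffunP => d; rewrite !ffunE !fE (inj_eq perm_inj).
- move=> i j eq_f; apply: coord_inj => d; apply: (@perm_inj _ (s d)).
  by rewrite -!fE eq_f.
- by apply: coord_inj => d; rewrite fE; case: (sP d).
- by apply: coord_inj => d; rewrite fE; case: (sP d).
Qed.

(** The entry at (k, l) of the Kronecker product indexed by i is 1 when i is 1
    exactly on the coordinates where k and l agree, and 0 otherwise.  The
    coefficient of that product is therefore the value of X at any pair with
    this agreement pattern, if there is one. *)
Lemma kron_span (K : comPzRingType) (X : 'M[K]_N) :
  (forall k l k' l', agree k l = agree k' l' -> X k l = X k' l') ->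
  exists alpha : {ffun 'I_D -> 'I_2} -> K,
    X = \sum_(i : {ffun 'I_D -> 'I_2})
      alpha i *: kron (fun d => if i d == ord0 then complete_mx K (M d) else 1%:M).
Proof.
move=> Xinv.
pose pat k l : {ffun 'I_D -> 'I_2} := [ffun d => if coord k d == coord l d then 1 else 0].
have pat_agree k l k' l' : pat k l = pat k' l' -> agree k l = agree k' l'.
  move/ffunP => e; apply/ffunP => d; have := e d; rewrite !ffunE.
  by case: eqP => _; case: eqP.
pose alpha (b : {ffun 'I_D -> 'I_2}) := if [pick q : 'I_N * 'I_N | pat q.1 q.2 == b] is Some q then X q.1 q.2 else 0.
exists alpha; apply/matrixP => k l; rewrite summxE (bigD1 (pat k l)) //=.
have entry (i : {ffun 'I_D -> 'I_2}) : kron (fun d => if i d == ord0 then complete_mx K (M d) else 1%:M) k l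
    = (i == pat k l)%:R.
  rewrite kronE; case: eqVneq => [->|/eqP ne].
    rewrite big1 // => d _; rewrite ffunE.
    by case: (eqVneq (coord k d) (coord l d)) => [->|kl]; rewrite /= mxE ?eqxx ?kl.
  have [d id] : exists d, i d != pat k l d.
    apply/existsP; apply: contraT => /existsPn e; case: ne; apply/ffunP => d.
    by have /negPn/eqP := e d.
  rewrite (bigD1 d) //=; move: id; rewrite ffunE.
  case: (i d) => -[|[|//]] lt_id; case: (eqVneq (coord k d) (coord l d)) => [->|kl] //=;
    by rewrite mxE ?eqxx ?(negPf kl) mul0r.
rewrite [X in _ = _ + X]big1 ?addr0 => [|i ik]; last by rewrite mxE entry (negPf ik) mulr0.
rewrite mxE entry eqxx mulr1 /alpha; case: pickP => [q /eqP/pat_agree qkl|/(_ (k, l))].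
  exact/esym/Xinv.
by rewrite eqxx.
Qed.
End Lattice.

(** * Mean and variance of the percolation matrix *)

Section Percolation.
Context (disp : measure_display) (T : measurableType disp) (R : realType).
Variables (P : probability T R) (D : nat) (M : 'I_D -> nat) (p : R).
Variables (G : T -> graph M).
Hypothesis G_perc : percolation P (lattice M) p G.
Local Notation N := (\prod_(d < D) M d)%N.

(** A function of the presence of one link is an affine function of an
    indicator; outside the lattice the link is never present. *)
Lemma expectation_link (phi : bool -> R) (l : {set node M}) :
  fine 'E_P[(fun w => phi (l \in G w))]%E =
  if l \in lattice M then (phi true - phi false) * p + phi false else phi false.
Proof.
case: ifPn => [lG|lG]; last first.
  rewrite (_ : (fun w => _) = cst (phi false)) ?expectation_cst //.
  apply/funext => w /=; congr phi; apply: contraNF lG.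
  exact: (fintype.subsetP (perc_sub G_perc w)).
have mE := perc_measurable G_perc l.
have LI : (\1_(link_event G l) : T -> R) \in Lfun P 1.
  by apply/Lfun1_integrable; apply: integrable_indic.
have -> : (fun w => phi (l \in G w)) =
    ((phi true - phi false) \o* \1_(link_event G l)) \+ cst (phi false).
  apply/funext => w /=; rewrite indicE.
  have -> : (w \in link_event G l) = (l \in G w).
    by apply/idP/idP => [/set_mem|] //; move=> h; apply/mem_set.
  by case: (l \in G w); rewrite /= ?mul1r ?mul0r; ring.
rewrite expectationD ?Lfun_cst //; last exact: Lfun_scale.
rewrite expectationZl // expectation_indic // expectation_cst.
by rewrite (perc_prob G_perc lG).
Qed.

Variables (a : R).
Let W w := a *: adjacency R (G w).

Lemma mean_mx_agree (i j i' j' : 'I_N) : agree i j = agree i' j' ->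
  mean_mx P W i j = mean_mx P W i' j'.
Proof.
move=> e; rewrite !mxE.
pose phi (b : bool) := a * b%:R.
have E k l : (fun w => W w k l) = (fun w => phi ([set node_of k; node_of l]%SET \in G w)).
  by apply/funext => w; rewrite !mxE.
by rewrite !E !expectation_link (mem_lattice_agree e).
Qed.

Lemma variance_mx_agree (i j i' j' : 'I_N) : agree i j = agree i' j' ->
  variance_mx P W i j = variance_mx P W i' j'.
Proof.
move=> e; rewrite !mxE.
pose phi k l (b : bool) := (a * b%:R - mean_mx P W k l) ^+ 2.
have E k l : (fun w => (W w - mean_mx P W) k l ^+ 2) =
    (fun w => phi k l ([set node_of k; node_of l]%SET \in G w)).
  by apply/funext => w; rewrite /phi; move: (mean_mx P W) => m; rewrite !mxE.
by rewrite !E !expectation_link (mem_lattice_agree e) /phi (mean_mx_agree e).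
Qed.

Lemma variance_mx_ge0 (i j : 'I_N) : 0 <= variance_mx P W i j.
Proof. by rewrite mxE fine_ge0 // expectation_ge0 // => w; exact: sqr_ge0. Qed.

Lemma mean_mx_sym : (mean_mx P W)^T = mean_mx P W.
Proof.
apply/matrixP => i j; rewrite mxE; apply: mean_mx_agree.
by apply/ffunP => d; rewrite !ffunE eq_sym.
Qed.

End Percolation.

(** * The form of the canonical matrix *)

Unset Implicit Arguments.

Theorem theorem2 (R : realType) (D : nat) (M : 'I_D -> nat) (p : R)
    (D_ge1 : (1 <= D)%N) (M_gt0 : forall d, (0 < M d)%N)
    (M_not_all1 : ~ (forall d, M d = 1%N)) (p01 : 0 <= p <= 1)
    (disp : measure_display) (T : measurableType disp) (P : probability T R)
    (G : T -> graph M) (G_perc : percolation P (lattice M) p G) :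
  let N := (\prod_(d < D) M d)%N in
  let gamma : R := (\sum_(d < D) (M d - 1))%N%:R in
  let W := fun w : T => gamma^-1 *: adjacency R (G w) in
  let B := mean_mx P W in
  let V := variance_mx P W in
  forall C : 'I_N -> R[i] -> R[i],
    (forall k, class_L (C k)) -> canonical_solution B V C ->
    forall z : R[i], complex.Im z != 0 ->
    exists alpha : {ffun 'I_D -> 'I_2} -> R[i],
      canonical_mx B V (fun s => C s z) z =
      \sum_(i : {ffun 'I_D -> 'I_2})
        alpha i *: kron (fun d =>
          if i d == ord0 then complete_mx R[i] (M d) else 1%:M).
Proof.
move=> N gamma W B V C C_L C_sol z z0.
pose c s := C s z.
have cz : same_side z c by move=> k; case: (C_L k z z0).
apply: kron_span => k l k' l' /lattice_two_point_homogeneous[f [f_agree f_inj <- <-]].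
apply/esym/canonical_mx_invariant => //.
- exact: mean_mx_sym G_perc _.
- exact: variance_mx_ge0.
- exact: C_sol.
- by move=> i j; apply: (mean_mx_agree G_perc); apply: f_agree.
- by move=> i j; apply: (variance_mx_agree G_perc); apply: f_agree.
Qed.
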